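(* Let $\mathcal{E}$ be a finite biordered set. Then the free idempotent generated semigroup $\mathsf{IG}(\mathcal{E})$ is a Fountain semigroup (i.e. a weakly abundant semigroup) satisfying the congruence condition.
   Context: For a semigroup $S$ with set of idempotents $E=E(S)$, the biordered set of $S$ is the partial algebra $\mathcal{E}_S=(E,\ast)$ in which $e\ast f$ is defined, and equal to $ef$, exactly when $\{e,f\}$ is a basic pair, i.e. $\{e,f\}\cap\{ef,fe\}\neq\varnothing$. A biordered set is a partial algebra isomorphic to some $\mathcal{E}_S$; it is finite if $E$ is finite ($S$ may be infinite). $\mathsf{IG}(\mathcal{E})$ is the semigroup presented by generators $\overline{E}=\{\overline{e}: e\in E\}$ and relations $\overline{e}\,\overline{f}=\overline{e\ast f}$ for all basic pairs $\{e,f\}$. Its idempotents are exactly the $\overline{e}$, $e\in E$. For a semigroup $S$, define $a\;\widetilde{\mathscr{R}}\;b$ iff for all $e\in E(S)$: $ea=a\Leftrightarrow eb=b$; and $a\;\widetilde{\mathscr{L}}\;b$ iff for all $e\in E(S)$: $ae=a\Leftrightarrow be=b$. $S$ is weakly abundant (a Fountain semigroup) if every $\widetilde{\mathscr{R}}$-class and every $\widetilde{\mathscr{L}}$-class of $S$ contains an idempotent. A weakly abundant semigroup satisfies the congruence condition if $\widetilde{\mathscr{R}}$ is a left congruence and $\widetilde{\mathscr{L}}$ is a right congruence. *)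

(* Defs.v *)
From HB Require Import structures.
From Corelib Require Export RelationClasses.
From mathcomp Require Export all_boot monoid generic_quotient boolp.

Set Implicit Arguments.
Unset Strict Implicit.
Unset Printing Implicit Defensive.

Local Open Scope group_scope.
Local Open Scope quotient_scope.

Definition idem (S : semigroupType) : pred S := [pred e | e * e == e].

(* The set E(S), as a type. *)
Definition idempotents (S : semigroupType) := {e : S | idem e}.

(* A partial binary operation on E is a function E -> E -> option E, with
   None for "undefined". *)
Section BiorderedSets.

Variable S : semigroupType.
Implicit Types e f : S.

Definition basic_pair e f :=
  [|| e * f == e, e * f == f, f * e == e | f * e == f].

Lemma basic_pair_idem e f :
  idem e -> idem f -> basic_pair e f -> idem (e * f).
Proof.
move=> /eqP ee /eqP ff /or4P[] /eqP h; apply/eqP; rewrite ?h ?ee ?ff //.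
- by rewrite mulgA -(mulgA e f e) h ee.
- by rewrite mulgA -(mulgA e f e) h -mulgA ff.
Qed.

(* insub never discards a product here: see biorder_starE. *)
Definition biorder_star (e f : idempotents S) : option (idempotents S) :=
  if basic_pair (val e) (val f) then insub (val e * val f) else None.

Lemma biorder_starE (e f : idempotents S) :
  omap val (biorder_star e f) =
  if basic_pair (val e) (val f) then Some (val e * val f) else None.
Proof.
rewrite /biorder_star; case: ifP => // ef.
by rewrite insubT //; apply: basic_pair_idem ef; apply: valP.
Qed.

End BiorderedSets.

Definition partial_iso (A B : Type) (starA : A -> A -> option A)
    (starB : B -> B -> option B) (phi : A -> B) : Prop :=
  bijective phi /\
  forall e f, omap phi (starA e f) = starB (phi e) (phi f).

Definition biordered_set (E : choiceType) (star : E -> E -> option E) : Prop :=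
  exists (S : semigroupType) (phi : E -> idempotents S),
    partial_iso star (@biorder_star S) phi.

(* The nonempty word x_0 x_1 ... x_n is encoded as (x_0, [:: x_1; ...; x_n]). *)
Definition free_semigroup (E : choiceType) : Type := E * seq E.

Section FreeSemigroup.

Variable E : choiceType.

HB.instance Definition _ := Choice.on (free_semigroup E).

Definition fs_gen (e : E) : free_semigroup E := (e, [::]).

Definition fs_mul (u v : free_semigroup E) : free_semigroup E :=
  (u.1, u.2 ++ v.1 :: v.2).

Lemma fs_mulA : associative fs_mul.
Proof. by move=> u v w; rewrite /fs_mul /= -catA. Qed.

HB.instance Definition _ := isSemigroup.Build (free_semigroup E) fs_mulA.

End FreeSemigroup.

Section FreeIdempotentGenerated.

Variables (E : choiceType) (star : E -> E -> option E).

(* In a biordered set, star e f is defined exactly when {e, f} is a basic pair,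
   so ig_rel ranges over the defining relations of IG(E). *)
Inductive ig_cong : free_semigroup E -> free_semigroup E -> Prop :=
| ig_rel e f g : star e f = Some g -> ig_cong (fs_gen e * fs_gen f) (fs_gen g)
| ig_refl u : ig_cong u u
| ig_sym u v : ig_cong u v -> ig_cong v u
| ig_trans u v w : ig_cong u v -> ig_cong v w -> ig_cong u w
| ig_mul u u' v v' :
    ig_cong u u' -> ig_cong v v' -> ig_cong (u * v) (u' * v').

Definition ig_congb : rel (free_semigroup E) := fun u v => `[< ig_cong u v >].

Lemma ig_congb_refl : reflexive ig_congb.
Proof. by move=> u; apply/asboolP; apply: ig_refl. Qed.

Lemma ig_congb_sym : symmetric ig_congb.
Proof. by move=> u v; apply/asboolP/asboolP; apply: ig_sym. Qed.

Lemma ig_congb_trans : transitive ig_congb.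
Proof.
by move=> v u w /asboolP uv /asboolP vw; apply/asboolP; apply: ig_trans uv vw.
Qed.

Canonical ig_equiv := EquivRel ig_congb ig_congb_refl ig_congb_sym ig_congb_trans.

Definition IG := {eq_quot ig_equiv}.

HB.instance Definition _ := Choice.on IG.
HB.instance Definition _ := EqQuotient.on IG.

Lemma IG_eqP (u v : free_semigroup E) :
  \pi_IG u = \pi_IG v <-> ig_cong u v.
Proof. by split=> [/eqmodP/asboolP|uv] //; apply/eqmodP/asboolP. Qed.

Definition IG_mul (x y : IG) : IG := \pi_IG (repr x * repr y).

Lemma IG_mul_pi (u v : free_semigroup E) :
  IG_mul (\pi_IG u) (\pi_IG v) = \pi_IG (u * v).
Proof. by apply/IG_eqP; apply: ig_mul; apply/IG_eqP; rewrite reprK. Qed.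

Lemma IG_mulA : associative IG_mul.
Proof.
elim/quotW=> u; elim/quotW=> v; elim/quotW=> w.
by rewrite (IG_mul_pi v w) (IG_mul_pi u v) (IG_mul_pi u) (IG_mul_pi _ w) mulgA.
Qed.

HB.instance Definition _ := isSemigroup.Build IG IG_mulA.

Lemma IG_piM (u v : free_semigroup E) :
  \pi_IG (u * v) = \pi_IG u * \pi_IG v.
Proof. by rewrite -IG_mul_pi. Qed.

Definition IG_gen (e : E) : IG := \pi_IG (fs_gen e).

Lemma IG_genM e f g : star e f = Some g -> IG_gen e * IG_gen f = IG_gen g.
Proof. by move=> efg; rewrite -IG_piM; apply/IG_eqP; apply: ig_rel. Qed.

End FreeIdempotentGenerated.

Section Fountain.

Variable S : semigroupType.
Implicit Types a b c e : S.

Definition tildeR a b : Prop := forall e, idem e -> (e * a = a <-> e * b = b).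
Definition tildeL a b : Prop := forall e, idem e -> (a * e = a <-> b * e = b).

Definition left_congruence (R : S -> S -> Prop) : Prop :=
  Equivalence R /\ forall a b c, R a b -> R (c * a) (c * b).
Definition right_congruence (R : S -> S -> Prop) : Prop :=
  Equivalence R /\ forall a b c, R a b -> R (a * c) (b * c).

End Fountain.

Definition fountain (S : semigroupType) : Prop :=
  (forall a : S, exists2 e : S, idem e & tildeR a e) /\
  (forall a : S, exists2 e : S, idem e & tildeL a e).

Definition congruence_condition (S : semigroupType) : Prop :=
  left_congruence (@tildeR S) /\ right_congruence (@tildeL S).

(* Main.v *)
From HB Require Import structures.
Require Import Defs.
From mathcomp Require Import all_boot monoid zify.

(** Everything rests on one property of a basic pair (e, f): by cases, either
    f e f = f or e f e = e.  In the first case e f is L-related to f, in the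
    second it is R-related to e, and this only uses the defining relations, so
    it holds in IG(E) as well as in the semigroup S whose idempotents are E.
    Semigroups are embedded in S^1, and words are possibly empty, to avoid
    separate cases for trivial factors.

    The R~-class of an element.  Let e act on the R-classes of S^1 by sending
    the class of q to the class of e q if q is R-related to an idempotent h with
    h e = h, and to the class of e otherwise (act).  By the property above these
    maps satisfy the relations of IG(E) (act_product), so the class obtained by
    applying a nonempty word w to 1 depends only on the element that w
    represents (plus_ev).  It contains an idempotent k, and k w = w in IG(E)
    (plus_sound).  If e w = w then e fixes the class of k, so e k = k in S and
    hence in IG(E).  Thus w and k are fixed by the same generators on the left
    (tilde_plus), and the class for c w is the image under c of the class for w,
    which makes the relation a left congruence (tilde_mul).

    R~ quantifies over all idempotents of IG(E), so it remains to see that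
    these are the generators (idempotent_gen, due to Easdown).  Call a letter e
    of a word u e v a seed if u e is L-related to e and e v is R-related to e;
    words with a seed represent regular elements.  Applying a defining relation
    preserves the existence of a seed, and also does not increase the number of
    factors needed to cut a word into factors that have seeds
    (blocks_expand, blocks_contract).  If W = w_1 .. w_n represents an
    idempotent, then so does every power of W; a high power can therefore be cut
    into at most n seeded factors, one of which is longer than two copies of W
    (blocks_long).  Next to its seed there is a full period, and x x = x turns
    this into a seed of W (seeded_periodic).  An element with a seed is
    R-related and L-related to generators, which for an idempotent forces
    equality with the generator that has the same image in S
    (idempotent_between).

    The statements about L~ follow by passing to the opposite monoids
    (ig_presentation_opposite). *)

Set Implicit Arguments.
Unset Strict Implicit.
Unset Printing Implicit Defensive.

Local Open Scope group_scope.
Local Open Scope quotient_scope.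

(** * Green's relation R in a monoid *)

Section Monoids.

Variable M : monoidType.
Implicit Types a b c e f g h q x y z : M.

(** Products are kept associated to the left; this form lets an equation
    [a * b = c] be applied behind any left factor x. *)
Lemma mulx2 a b c : a * b = c -> forall x, x * a * b = x * c.
Proof. by move=> <- x; rewrite mulgA. Qed.

Lemma mulx3 a b c d : a * b * c = d -> forall x, x * a * b * c = x * d.
Proof. by move=> <- x; rewrite !mulgA. Qed.

Definition greenR a b := (exists s, b = a * s) /\ (exists s, a = b * s).

Lemma greenR_refl a : greenR a a.
Proof. by split; exists 1; rewrite mulg1. Qed.

Lemma greenR_sym a b : greenR a b -> greenR b a.
Proof. by case. Qed.

Lemma greenR_trans a b c : greenR a b -> greenR b c -> greenR a c.
Proof.
move=> [[s ->] [s' as']] [[t ->] [t' bt']]; split.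
  by exists (s * t); rewrite mulgA.
by exists (t' * s'); rewrite {1}as' {1}bt' !mulgA.
Qed.

Lemma greenR_mul c a b : greenR a b -> greenR (c * a) (c * b).
Proof.
move=> [[s bE] [t aE]]; split.
  by exists s; rewrite -mulgA -bE.
by exists t; rewrite -mulgA -aE.
Qed.

Lemma greenR_fix e a b : greenR a b -> e * a = a -> e * b = b.
Proof. by move=> [[s ->] _] ea; rewrite mulgA ea. Qed.

Lemma greenR_idem h q : h * h = h -> greenR h q -> h * q = q.
Proof. by move=> hh /greenR_fix; apply. Qed.

End Monoids.

(** * An action of the generators on R-classes *)

Section Action.

Variables (T : monoidType) (E : Type) (i : E -> T).
Hypothesis i_idem : forall e, i e * i e = i e.
(* The left unit i f ensures that t is represented even if t = 1: then
   i f = 1 = t. *)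
Hypothesis i_onto :
  forall f t, t * t = t -> i f * t = t -> exists h, i h = t.
Implicit Types (e f h k : E) (q : T).

(** When [e] and [q] merge, e q is L-related to q in the free object: with q R h
    and h e = h, the pair (e, h) is basic. *)
Definition merges e q := exists2 h, greenR (i h) q & i h * i e = i h.

(** Up to R, this prepends e to a word whose longest regular prefix has image q:
    either that prefix grows by e, or only e is left of it. *)
Definition act e q : T := if `[< merges e q >] then i e * q else i e.

Lemma act_merges e q : merges e q -> act e q = i e * q.
Proof. by rewrite /act => /asboolP->. Qed.

Lemma act_nmerges e q : ~ merges e q -> act e q = i e.
Proof. by rewrite /act; case: asboolP. Qed.

Lemma merges_greenR e q q' : greenR q q' -> merges e q -> merges e q'.
Proof. by move=> qq' [h hq he]; exists h => //; apply: greenR_trans qq'. Qed.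

Lemma act_greenR e q q' : greenR q q' -> greenR (act e q) (act e q').
Proof.
move=> qq'; have [m|m] := pselect (merges e q).
  by rewrite (act_merges m) (act_merges (merges_greenR qq' m)); apply: greenR_mul.
have m' : ~ merges e q' by move/(merges_greenR (greenR_sym qq')).
by rewrite (act_nmerges m) (act_nmerges m'); apply: greenR_refl.
Qed.

Section Product.

Variables e f k : E.
Hypothesis kE : i k = i e * i f.
Hypothesis ef_regular :
  i f * i e * i f = i f \/ i e * i f * i e = i e.

Lemma merges_factor q : merges k q -> merges f q.
Proof.
move=> [h hq hk]; exists h => //.
by rewrite -hk kE -!mulgA i_idem.
Qed.

(** If h and q are R-related with h f = h, then a witness k1 that e merges with f q
    gives the witness h k1 f for the product e f, and a witness h2 for e f gives
    back f h2 e. *)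
Lemma merges_product q : merges f q -> (merges e (i f * q) <-> merges k q).
Proof.
move=> [h hq hf]; split.
  move=> [k1 k1q k1e]; have k1k1 := i_idem k1.
  have hh := i_idem h; have hqq := greenR_idem hh hq.
  case: hq => [[s qE] [s' hE]]; case: (k1q) => [[v fqE] [u k1E]].
  have fhk1 : i f * i h * i k1 = i k1.
    by rewrite k1E !mulgA (mulx2 hf) (mulx2 hqq).
  have k1fh : i k1 * i f * i h = i f * i h.
    by rewrite hE !mulgA (mulx2 fqE) mulgA k1k1 -fqE.
  have k1fef : i k1 * i f * i e * i f = i k1 * i f.
    case: ef_regular => [fef|efe]; first by rewrite (mulx3 fef).
    by rewrite -[in LHS]k1e (mulx3 efe) k1e.
  have [|| h2 h2E] := i_onto (f := h) (t := i h * i k1 * i f).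
  - by rewrite !mulgA (mulx3 fhk1) (mulx2 k1k1).
  - by rewrite !mulgA hh.
  have h2h : i h2 * i h = i h.
    by rewrite h2E (mulx3 k1fh) mulgA hf hh.
  exists h2; last first.
    rewrite h2E kE !mulgA -!(mulgA (i h)) -!mulgA.
    by congr (_ * _); rewrite !mulgA.
  split; first by exists q; rewrite -{1}hqq -h2h -mulgA hqq.
  by exists (s' * i k1 * i f); rewrite h2E {1}hE !mulgA.
move=> [h2 h2q h2k]; case: (h2q) => [[s qE] [s' h2E]].
have h2h2 := i_idem h2.
have h2ef : i h2 * i e * i f = i h2 by rewrite -mulgA -kE.
have h2f : i h2 * i f = i h2 by rewrite -h2ef -mulgA i_idem.
have [|| k1 k1E] := i_onto (f := f) (t := i f * i h2 * i e).
- by rewrite !mulgA (mulx3 h2ef) (mulx2 h2h2).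
- by rewrite !mulgA i_idem.
exists k1; last by rewrite k1E -mulgA i_idem.
split; last by exists (s' * i e); rewrite k1E {1}h2E !mulgA.
by exists (i f * i h2 * s); rewrite k1E qE !mulgA (mulx3 h2ef) (mulx2 h2h2).
Qed.

Lemma merges_regular q : i f * i e * i f = i f ->
  merges f q -> merges e (i f * q).
Proof.
move=> fef [h hq hf]; case: (hq) => [[s qE] [s' hE]]; have hh := i_idem h.
have hefh : i h * i e * i f * i h = i h by rewrite -{1}hf (mulx3 fef) hf hh.
have [|| k1 k1E] := i_onto (f := f) (t := i f * i h * i e).
- rewrite !mulgA; congr (_ * _); rewrite -!mulgA; congr (_ * _).
  by rewrite !mulgA.
- by rewrite !mulgA i_idem.
exists k1; last by rewrite k1E -mulgA i_idem.
split; last by exists (s' * i e); rewrite k1E {1}hE !mulgA.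
exists (i f * i h * s); rewrite k1E qE !mulgA; congr (_ * _).
by rewrite -!mulgA; congr (_ * _); rewrite !mulgA.
Qed.

Lemma merges_base : i f * i e * i f = i f -> merges e (i f).
Proof.
move=> fef; have [|| h hE] := i_onto (f := f) (t := i f * i e).
- by rewrite !mulgA fef.
- by rewrite mulgA i_idem.
exists h; last by rewrite hE -mulgA i_idem.
split; first by exists (i f); rewrite hE.
by exists (i e).
Qed.

(** The two sides agree up to R even though the default value of [act] may be
    taken at different stages: the default values e and e f are then R-related,
    because f e f = f would have forced e to merge. *)
Lemma act_product q : greenR (act e (act f q)) (act k q).
Proof.
have eRk : ~ i f * i e * i f = i f -> greenR (i e) (i k).
  move=> nfef; split; first by exists (i f).
  by exists (i e); rewrite kE; case: ef_regular.
have [mf|nmf] := pselect (merges f q); last first.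
  have nmk : ~ merges k q by move/merges_factor.
  rewrite (act_nmerges nmf) (act_nmerges nmk).
  have [m|nm] := pselect (merges e (i f)).
    by rewrite (act_merges m) kE; apply: greenR_refl.
  by rewrite (act_nmerges nm); apply: eRk => /merges_base.
rewrite (act_merges mf); have mE := merges_product mf.
have [m|nm] := pselect (merges k q).
  rewrite (act_merges m) act_merges ?mE //.
  by rewrite kE mulgA; apply: greenR_refl.
rewrite (act_nmerges nm) act_nmerges ?mE //.
by apply: eRk => fef; apply: nm; apply/mE; apply: merges_regular.
Qed.

End Product.

End Action.

(** * Words with a seed *)

(** Two ways of cutting a word are compared by which cut comes first; the first
    alternative includes the case of equal cuts. *)
Lemma cat_eq_cat (A : Type) (a b c d : seq A) : a ++ b = c ++ d ->
  (exists2 s, c = a ++ s & b = s ++ d)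
  \/ (exists x s, a = c ++ x :: s /\ d = x :: s ++ b).
Proof.
elim: a c => [|x a IHa] [|y c] /=.
- by move=> ->; left; exists [::].
- by move=> ->; left; exists (y :: c).
- by move=> <-; right; exists x, a.
case=> <- /IHa[[s -> ->]|[z [s [-> ->]]]]; first by left; exists s.
by right; exists z, s.
Qed.

Definition segment (E : Type) (a : nat -> E) p l := [seq a j | j <- iota p l].

Lemma segmentD (E : Type) (a : nat -> E) p l m :
  segment a p (l + m) = segment a p l ++ segment a (p + l) m.
Proof. by rewrite /segment iotaD map_cat. Qed.

Lemma size_segment (E : Type) (a : nat -> E) p l : size (segment a p l) = l.
Proof. by rewrite size_map size_iota. Qed.

Section Words.

Variables (M : monoidType) (E : Type) (g : E -> M).
Implicit Types (e f h k d : E) (s t u v w : seq E) (x y z : M).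

Definition ev w := \prod_(e <- w) g e.

Lemma ev_nil : ev [::] = 1.
Proof. exact: big_nil. Qed.

Lemma ev_cons e w : ev (e :: w) = g e * ev w.
Proof. exact: big_cons. Qed.

Lemma ev_cat u v : ev (u ++ v) = ev u * ev v.
Proof. exact: big_cat. Qed.

Definition evE := (ev_cons, ev_cat, ev_nil, @mulg1 M, @mul1g M, @mulgA M).

(** Equivalently, u e is L-related to e: u e is always a left multiple of e. *)
Definition absorbsL u e := exists y, y * ev u * g e = g e.
Definition absorbsR e v := exists y, g e * ev v * y = g e.

Definition seeded w :=
  exists u e v, [/\ w = u ++ e :: v, absorbsL u e & absorbsR e v].

Lemma absorbsL_nil e : absorbsL [::] e.
Proof. by exists 1; rewrite ev_nil !mul1g. Qed.

Lemma absorbsR_nil e : absorbsR e [::].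
Proof. by exists 1; rewrite ev_nil !mulg1. Qed.

Lemma absorbsL_suffix u v e : absorbsL (u ++ v) e -> absorbsL v e.
Proof. by case=> y; rewrite !evE => yuve; exists (y * ev u). Qed.

Lemma absorbsR_prefix e u v : absorbsR e (u ++ v) -> absorbsR e u.
Proof. by case=> z; rewrite !evE => euvz; exists (ev v * z); rewrite mulgA. Qed.

Lemma absorbsL_ev u u' e : ev u = ev u' -> absorbsL u e -> absorbsL u' e.
Proof. by rewrite /absorbsL => ->. Qed.

Lemma absorbsR_ev e v v' : ev v = ev v' -> absorbsR e v -> absorbsR e v'.
Proof. by rewrite /absorbsR => ->. Qed.

Lemma seeded1 e : seeded [:: e].
Proof.
exists [::], e, [::]; split=> //; [exact: absorbsL_nil|exact: absorbsR_nil].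
Qed.

(** The least such number of factors plays the role of the length of a minimal
    factorization into regular elements. *)
Inductive blocks : nat -> seq E -> Prop :=
| blocks0 : blocks 0 [::]
| blocksS n b w : seeded b -> blocks n w -> blocks n.+1 (b ++ w).

Lemma blocks_size w : blocks (size w) w.
Proof.
elim: w => [|e w IHw]; first exact: blocks0.
exact: (blocksS (seeded1 e) IHw).
Qed.

Lemma blocks_cat m n v w : blocks m v -> blocks n w -> blocks (m + n) (v ++ w).
Proof.
move=> mv nw; elim: mv => [|{}m b {}v bS _ IH] //.
by rewrite -catA; apply: blocksS.
Qed.

Lemma blocks_inv n e w : blocks n (e :: w) ->
  exists n' v w', [/\ n = n'.+1, w = v ++ w', seeded (e :: v) & blocks n' w'].
Proof.
move ew: (e :: w) => ewv nw; case: nw ew => [//|{}n b w' bS w'B].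
case: b bS => [|e' v] bS; first by have [[|? ?] [? [? []]]] := bS.
by case=> -> ->; exists n, v, w'.
Qed.

Section Contraction.

Variables e f k : E.
Hypothesis kE : g k = g e * g f.
Hypothesis ef_regular :
  g f * g e * g f = g f \/ g e * g f * g e = g e.

Let contract_ev t : ev (e :: f :: t) = ev (k :: t).
Proof. by rewrite !evE kE. Qed.

(** A seed outside k survives because the value of its context is unchanged.
    If k itself is the seed, then so is f when f e f = f, since e f L f, and so
    is e when e f e = e, since e f R e. *)
Lemma seeded_expand s t : seeded (s ++ k :: t) -> seeded (s ++ e :: f :: t).
Proof.
move=> [u [d [v [stE uL vR]]]].
case: (cat_eq_cat stE) => [[c uE]|[d' [c [sE]]]]; last first.
  case=> dE vE; exists u, d, (c ++ e :: f :: t).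
  rewrite sE -dE -catA; split=> //; apply: absorbsR_ev vR.
  by rewrite vE !ev_cat contract_ev.
case: c uE => [|k' c] uE [] kd; last first.
  move=> tE; exists (s ++ e :: f :: c), d, v; rewrite tE -catA; split=> //.
  apply: absorbsL_ev uL; rewrite uE -kd !ev_cat; congr (_ * _).
  by rewrite -contract_ev.
move=> tE; subst d v; rewrite cats0 in uE; subst u.
have [y yk] := uL; have [z kz] := vR; case: ef_regular => [fef|efe].
  exists (s ++ [:: e]), f, t; split; first by rewrite -catA.
    exists (g f * y); rewrite !evE -(mulgA _ (g e)) -kE.
    by rewrite -!mulgA (mulgA y) yk kE mulgA.
  exists z; rewrite -[in LHS]fef -(mulgA (g f)) -kE.
  by rewrite -!mulgA (mulgA (g k)) kz kE mulgA.
exists s, e, (f :: t); split=> //.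
  by exists y; rewrite -[in LHS]efe -kE !mulgA yk kE efe.
by exists (z * g e); rewrite !evE -kE kz kE efe.
Qed.

(** If f is the seed, then s e f L f gives f e f = f whichever of the two
    regularity equations holds, so e f is a seed; symmetrically for e. *)
Lemma seeded_contract s t : seeded (s ++ e :: f :: t) -> seeded (s ++ k :: t).
Proof.
move=> [u [d [v [stE uL vR]]]].
case: (cat_eq_cat stE) => [[c uE]|[d' [c [sE]]]]; last first.
  case=> dE vE; exists u, d, (c ++ k :: t).
  rewrite sE -dE -catA; split=> //; apply: absorbsR_ev vR.
  by rewrite vE !ev_cat contract_ev.
case: c uE => [|e' [|f' c]] uE [] ed; last first.
- move=> fE tE; exists (s ++ k :: c), d, v; rewrite tE -catA; split=> //.
  apply: absorbsL_ev uL; rewrite uE -ed -fE !ev_cat; congr (_ * _).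
  by rewrite contract_ev.
- move=> fE tE; subst d v e' u; have [y ysef] := uL; have [z ftz] := vR.
  have fef : g f * g e * g f = g f.
    case: ef_regular => // efe.
    by rewrite -[X in X * _ * _]ysef !evE (mulx3 efe) -[RHS]ysef !evE.
  exists s, k, t; split=> //.
    by exists (g e * y); rewrite kE -[in RHS]ysef !evE.
  by exists z; rewrite kE -!mulgA (mulgA (g f)) ftz.
move=> vE; subst d v; rewrite cats0 in uE; subst u.
have [y yse] := uL; have [z eftz] := vR.
have efe : g e * g f * g e = g e.
  case: ef_regular => // fef.
  by rewrite -[X in _ * X]eftz !evE (mulx3 fef) -[RHS]eftz !evE.
exists s, k, t; split=> //; first by exists y; rewrite kE mulgA yse.
by rewrite ev_cons mulgA in eftz; exists (z * g f); rewrite kE mulgA eftz.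
Qed.

(** As e f is L-related to f, the letter e f can replace f in front of t, and the
    absorption of s into e carries over to any seed of f t. *)
Lemma seeded_joinl s t : absorbsL s e -> seeded (f :: t) ->
  g f * g e * g f = g f -> seeded (s ++ k :: t).
Proof.
move=> [y yse] [[|f' u] [d [v [/= [<- ->] uL vR]]]] fef.
  exists s, k, v; split=> //; first by exists y; rewrite kE mulgA yse.
  by have [z fvz] := vR; exists z; rewrite kE -!mulgA (mulgA (g f)) fvz.
exists (s ++ k :: u), d, v; rewrite -catA; split=> //.
have [x fud] := uL; exists (x * g f * y); rewrite !evE in fud *.
by rewrite kE !mulgA (mulx3 yse) (mulx3 fef).
Qed.

Lemma seeded_joinr s t : seeded (rcons s e) -> absorbsR f t ->
  g e * g f * g e = g e -> seeded (s ++ k :: t).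
Proof.
move=> [u [d [v [sE uL vR]]]] [z ftz] efe.
case: (lastP v) sE vR => [|{}v e']; rewrite ?cats1 -?rcons_cons -?rcons_cat.
  move=> /rcons_inj[sE de] _; rewrite -sE -de in uL; exists s, k, t; split=> //.
    by have [y yse] := uL; exists y; rewrite kE mulgA yse.
  by exists z; rewrite kE -!mulgA (mulgA (g f)) ftz.
move=> /rcons_inj[-> <-] [x dve]; exists u, d, (v ++ k :: t).
rewrite -catA; split=> //; exists (z * g e * x).
rewrite -cats1 !evE in dve *; rewrite kE !mulgA.
by rewrite (mulx3 ftz) (mulx3 efe).
Qed.

(** When a relation is applied across the boundary of two factors, the letter e f
    can be given to the factor whose letter is L- or R-related to it.  The other
    factor keeps its seed, unless the seed was the letter it lost, in which case
    the two factors fuse into one. *)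
Lemma blocks_join s t : seeded (rcons s e) -> seeded (f :: t) ->
  exists2 n, (n <= 2)%N & blocks n (s ++ k :: t).
Proof.
have block1 w : seeded w -> blocks 1 w.
  by move=> seeded_w; rewrite -[w]cats0; apply: blocksS => //; apply: blocks0.
have block2 u v : seeded u -> seeded v -> blocks 2 (u ++ v).
  by move=> seeded_u seeded_v; apply: blocksS => //; apply: block1.
move=> se ft; case: ef_regular => [fef|efe].
  have [u [d [v [sE uL vR]]]] := se.
  case: (lastP v) sE vR => [|{}v e']; rewrite ?cats1 -?rcons_cons -?rcons_cat.
    move=> /rcons_inj[sE eE] _; exists 1%N => //; apply: block1.
    by apply: seeded_joinl; rewrite // sE eE.
  move=> /rcons_inj[-> _]; rewrite -cats1 => /absorbsR_prefix vR.
  exists 2 => //; apply: block2; first by exists u, d, v.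
  exact: (seeded_joinl (absorbsL_nil e) ft fef).
have [[|f' u] [d [v [/= [fE tE] uL vR]]]] := ft.
  exists 1%N => //; apply: block1.
  by apply: seeded_joinr; rewrite // tE fE.
exists 2 => //; rewrite -cat_rcons; apply: block2.
  by rewrite -cats1; apply: (seeded_joinr se (absorbsR_nil f) efe).
by exists u, d, v; split=> //; apply: (@absorbsL_suffix [:: f']).
Qed.

Lemma blocks_expand n s t :
  blocks n (s ++ k :: t) -> blocks n (s ++ e :: f :: t).
Proof.
move wE: (s ++ k :: t) => w nw.
elim: nw s wE => [|m b w' bS w'B IH] s wE; first by case: s wE.
case: (cat_eq_cat (esym wE)) => [[s' -> w'E]|[k' [b' [bE [kk' tE]]]]].
  by rewrite -catA; apply: blocksS => //; apply: IH.
rewrite bE -kk' in bS; rewrite tE -!cat_cons catA.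
exact: blocksS (seeded_expand bS) w'B.
Qed.

Lemma blocks_contract n s t : blocks n (s ++ e :: f :: t) ->
  exists2 m, (m <= n)%N & blocks m (s ++ k :: t).
Proof.
move wE: (s ++ e :: f :: t) => w nw.
elim: nw s wE => [|{}n b w' bS w'B IH] s wE; first by case: s wE.
case: (cat_eq_cat (esym wE)) => [[s' -> w'E]|[e' [b' [bE [ee' tE]]]]].
  have [m le_mn mB] := IH _ (esym w'E).
  by exists m.+1; rewrite // -catA; apply: blocksS.
rewrite -{}ee' in bE; case: b' tE bE => [|f' b'] /= => [w'E bE|[<- ->] bE].
  rewrite -w'E in w'B.
  have [n' [v [w2 [-> -> fvS w2B]]]] := blocks_inv w'B.
  rewrite bE cats1 in bS; have [m le_m2 mB] := blocks_join bS fvS.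
  exists (m + n')%N; first by rewrite -addn2 addnC leq_add2l.
  by rewrite -cat_cons catA; apply: blocks_cat.
exists n.+1 => //; rewrite -cat_cons catA; apply: blocksS => //.
by apply: seeded_contract; rewrite -bE.
Qed.

End Contraction.

(** Pigeonhole: more than n * m letters are cut into n factors. *)
Lemma blocks_long (a : nat -> E) n m p l : (n * m < l)%N ->
  blocks n (segment a p l) ->
  exists p' l', (m < l')%N /\ seeded (segment a p' l').
Proof.
move wE: (segment a p l) => w lt_nm nw.
elim: nw p l wE lt_nm => [|{}n b w' bS _ IH] p l wE lt_nm.
  by case: l wE lt_nm.
have le_bl : (size b <= l)%N.
  by rewrite -(size_segment a p l) wE size_cat leq_addr.
move: wE; rewrite -(subnKC le_bl) segmentD => wE.
have [bE w'E] : segment a p (size b) = b /\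
    segment a (p + size b) (l - size b) = w'.
  have := congr1 (drop (size b)) wE; have := congr1 (take (size b)) wE.
  by rewrite !take_size_cat ?drop_size_cat ?size_segment.
have [lt_mb|le_bm] := ltnP m (size b).
  by exists p, (size b); rewrite bE.
apply: IH w'E _; rewrite ltn_subRL (leq_ltn_trans _ lt_nm) //.
by rewrite mulSn leq_add2r.
Qed.

(** For x = u e v idempotent, y e v u e = e and x x = x give e v u e v = e v,
    hence y e v = e v; so y can be dropped and e v u e = e, which shows that e
    absorbs u on the left and v on the right. *)
Lemma seeded_cycleL u e v :
  ev (u ++ e :: v) * ev (u ++ e :: v) = ev (u ++ e :: v) ->
  absorbsL (e :: v ++ u) e -> seeded (u ++ e :: v).
Proof.
rewrite /absorbsL !evE => xx [y]; rewrite !evE => yevue.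
have evuev : g e * ev v * ev u * g e * ev v = g e * ev v.
  have := congr1 (fun x => y * g e * ev v * x) xx.
  by rewrite !mulgA yevue.
have yev : y * g e * ev v = g e * ev v.
  by have := congr1 (fun x => y * x) evuev; rewrite !mulgA yevue.
exists u, e, v; split=> //; first by exists (y * g e * ev v).
by exists (ev u * g e); rewrite !mulgA -yev.
Qed.

Lemma seeded_cycleR u e v :
  ev (u ++ e :: v) * ev (u ++ e :: v) = ev (u ++ e :: v) ->
  absorbsR e (v ++ rcons u e) -> seeded (u ++ e :: v).
Proof.
rewrite /absorbsR -cats1 !evE => xx [z evuez].
have uevue : ev u * g e * ev v * ev u * g e = ev u * g e.
  have := congr1 (fun x => x * (ev u * g e * z)) xx.
  by rewrite -!mulgA; rewrite -!mulgA in evuez; rewrite evuez.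
have uez : ev u * g e * z = ev u * g e.
  have := congr1 (fun x => x * z) uevue.
  by rewrite -!mulgA; rewrite -!mulgA in evuez; rewrite evuez.
exists u, e, v; split=> //; last first.
  by exists (ev u * g e * z); rewrite !mulgA in evuez *.
exists (g e * ev v); rewrite -!mulgA in uez evuez *.
by rewrite -uez evuez.
Qed.

(** * Powers of a word *)

Section Periodic.

Variables (e0 : E) (W : seq E).
Hypothesis W_gt0 : (0 < size W)%N.
Let n := size W.
(* The default letter e0 is never reached, as j %% n < n. *)
Let a j := nth e0 W (j %% n).

Lemma segment_rot j :
  segment a j n = drop (j %% n) W ++ take (j %% n) W.
Proof.
have: (j %% n < n)%N by rewrite ltn_mod.
have mod_q r : (j %% n + r = j + r %[mod n])%N by rewrite modnDml.
move: (j %% n)%N mod_q => q mod_q lt_qn.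
apply: (@eq_from_nth _ e0) => [|r]; rewrite size_segment.
  by rewrite -[RHS]/(size (rot _ W)) size_rot.
move=> lt_rn; rewrite (nth_map 0%N) ?size_iota // nth_iota // /a -mod_q.
rewrite nth_cat size_drop -/n nth_drop; case: ltnP => [lt_r|le_r].
  by rewrite modn_small //; lia.
rewrite nth_take; last by lia.
have -> : (q + r = r - (n - q) + n)%N by lia.
by rewrite modnDr modn_small //; lia.
Qed.

Lemma ev_segment_power m : ev W * ev W = ev W ->
  ev (segment a 0 (n * m.+1)) = ev W.
Proof.
move=> WW; have WE c : segment a (n * c) n = W.
  by rewrite segment_rot modnMr drop0 take0 cats0.
elim: m => [|m IHm]; first by have := WE 0%N; rewrite muln0 muln1 => ->.
by rewrite mulnS addnC segmentD ev_cat IHm add0n WE.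
Qed.

(** A seed of a factor of W^infinity longer than two periods has a full period on
    its left or on its right, so it absorbs the rotation of W that starts or ends
    there; this is what the cyclic lemmas require. *)
Lemma seeded_periodic p l : (2 * n < l)%N -> ev W * ev W = ev W ->
  seeded (segment a p l) -> seeded W.
Proof.
move=> lt_2nl WW [u [e [v [uevE uL vR]]]].
set r := size u; set j := (p + r)%N.
have lE : l = (r + (size v).+1)%N by rewrite -(size_segment a p l) uevE size_cat.
move: uevE; rewrite lE segmentD -/j /segment /= -!/(segment _ _ _) => uevE.
have uE : u = segment a p r.
  by have := congr1 (take r) uevE; rewrite !take_size_cat ?size_segment.
have [eE vE] : e = a j /\ v = segment a j.+1 (size v).
  by have := congr1 (drop r) uevE; rewrite !drop_size_cat ?size_segment // => -[].
have lt_qn : (j %% n < n)%N by rewrite ltn_mod.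
set W1 := take (j %% n) W; set W2 := drop (j %% n).+1 W.
have WE : W = W1 ++ e :: W2 by rewrite eE -drop_nth // cat_take_drop.
have rotE : segment a j n = e :: W2 ++ W1.
  by rewrite segment_rot eE (drop_nth e0).
rewrite WE in WW *; have [le_nr|lt_rn] := leqP n r.
  apply: seeded_cycleL => //; rewrite -rotE.
  have -> : segment a j n = segment a (j - n) n.
    have le_nj : (n <= j)%N by apply: leq_trans (leq_addl p r).
    by rewrite !segment_rot -(modnDr (j - n)) subnK.
  apply: (@absorbsL_suffix (segment a p (r - n))).
  by rewrite -addnBA // -segmentD subnK // -uE.
have le_nv : (n <= size v)%N by lia.
apply: seeded_cycleR => //.
apply: (@absorbsR_prefix _ _ (segment a (j.+1 + n) (size v - n))).
suff <- : segment a j.+1 n = W2 ++ rcons W1 e by rewrite -segmentD subnKC // -vE.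
have: segment a j (1 + n) = segment a j (n + 1) by rewrite addnC.
rewrite [RHS]segmentD rotE /segment /= -!/(segment _ _ _) => -[_ ->].
by rewrite -cats1 catA eE /a modnDr.
Qed.

End Periodic.

End Words.

(** * Presentations of free idempotent generated monoids *)

Section Basic.

Variable M : monoidType.
Implicit Types e f : M.

Definition basic e f := [\/ e * f = e, e * f = f, f * e = e | f * e = f].

Lemma basic_regular e f : e * e = e -> f * f = f -> basic e f ->
  f * e * f = f \/ e * f * e = e.
Proof.
move=> ee ff [] ef; [right|left|right|left].
- by rewrite ef.
- by rewrite -mulgA ef.
- by rewrite -mulgA ef.
- by rewrite ef.
Qed.

End Basic.

Definition opposite (M : Type) : Type := M.

Section Opposite.

Variable M : monoidType.

HB.instance Definition _ := Choice.on (opposite M).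

Definition opposite_mul (x y : opposite M) : opposite M := (y : M) * (x : M).

Let opposite_mulA : associative opposite_mul.
Proof. by move=> x y z; rewrite /opposite_mul mulgA. Qed.

Let opposite_mul1 : left_id (1 : M) opposite_mul.
Proof. by move=> x; apply: mulg1. Qed.

Let opposite_1mul : right_id (1 : M) opposite_mul.
Proof. by move=> x; apply: mul1g. Qed.

HB.instance Definition _ :=
  isMonoid.Build (opposite M) opposite_mulA opposite_mul1 opposite_1mul.

End Opposite.

(** [M] is IG(E) with a unit adjoined and [T] is S with a unit adjoined.  Stating
    the properties used for arbitrary monoids makes the notion stable under
    taking opposites of both, which yields all left-right duals.  The field
    [gen_ind] says that equality in [M] is generated by the defining
    relations: a property of words that they preserve depends only on the
    element represented. *)
Record ig_presentation (E : Type) (star : E -> E -> option E)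
    (T M : monoidType) (i : E -> T) (g : E -> M) : Prop := IgPresentation {
  i_inj : injective i;
  i_idem : forall e, i e * i e = i e;
  i_onto : forall t, t * t = t -> t = 1 \/ exists e, i e = t;
  star_total : forall e f, basic (i e) (i f) -> exists k, star e f = Some k;
  star_basic : forall e f k, star e f = Some k -> basic (i e) (i f);
  star_mul : forall e f k, star e f = Some k -> i e * i f = i k;
  gen_star : forall e f k, star e f = Some k -> g e * g f = g k;
  gen_onto : forall x, exists w, ev g w = x;
  gen_ind : forall P : seq E -> Prop,
    (forall s e f k t, star e f = Some k ->
       P (s ++ e :: f :: t) <-> P (s ++ k :: t)) ->
    forall u v, ev g u = ev g v -> P u -> P v
}.

Lemma ev_opposite (E : Type) (M : monoidType) (g : E -> M) w :
  @ev (opposite M) E g w = ev g (rev w).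
Proof.
elim: w => [|e w IHw]; first by rewrite /ev !big_nil.
by rewrite rev_cons -cats1 ev_cat !ev_cons IHw ev_nil mulg1.
Qed.

Lemma ig_presentation_opposite (E : Type) (star : E -> E -> option E)
    (T M : monoidType) (i : E -> T) (g : E -> M) :
  ig_presentation star i g ->
  @ig_presentation E (fun e f => star f e) (opposite T) (opposite M) i g.
Proof.
have basicC e f : @basic (opposite T) (i e) (i f) <-> basic (i f) (i e).
  by split=> -[] h;
    [constructor 2|constructor 1|constructor 4|constructor 3
    |constructor 2|constructor 1|constructor 4|constructor 3].
move=> P; split; rewrite ?/mul /=.
- exact: i_inj P.
- exact: i_idem P.
- exact: i_onto P.
- by move=> e f /basicC; apply: star_total P _ _.
- by move=> e f k /(star_basic P)/basicC.
- by move=> e f k /(star_mul P).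
- by move=> e f k /(gen_star P).
- by move=> x; have [w <-] := gen_onto P x; exists (rev w);
  rewrite ev_opposite revK.
move=> Q Qstar u v; rewrite !ev_opposite => uv Qu.
rewrite -[v]revK; apply: (gen_ind P (P := fun w => Q (rev w))) uv _.
  move=> s e f k t efk; rewrite !rev_cat !rev_cons -!cats1 -!catA /=.
  exact: Qstar.
by rewrite revK.
Qed.

Section Presentation.

Variables (E : Type) (star : E -> E -> option E).
Variables (T M : monoidType) (i : E -> T) (g : E -> M).
Hypothesis P : ig_presentation star i g.
Implicit Types (e f h k l j : E) (u v w : seq E) (x : M) (t : T).

Let ii := i_idem P.

Lemma i_onto_left f t : t * t = t -> i f * t = t -> exists h, i h = t.
Proof.
by move=> /(i_onto P)[->|//]; rewrite mulg1; exists f.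
Qed.

Lemma gen_mul e f k : basic (i e) (i f) -> i e * i f = i k -> g e * g f = g k.
Proof.
move=> /(star_total P)[k' efk'] efk.
by rewrite (gen_star P efk'); congr (g _); apply: (i_inj P);
  rewrite -efk (star_mul P efk').
Qed.

Lemma gen_idem e : g e * g e = g e.
Proof. by apply: gen_mul; rewrite ?ii //; constructor 1. Qed.

Lemma gen_regular e f k : star e f = Some k ->
  g f * g e * g f = g f \/ g e * g f * g e = g e.
Proof.
move=> /(star_basic P) ef; apply: basic_regular; try exact: gen_idem.
have fe : basic (i f) (i e).
  by case: ef => h; [constructor 4|constructor 3|constructor 2|constructor 1].
case: (ef) => h; [constructor 1|constructor 2|constructor 3|constructor 4];
  exact: gen_mul.
Qed.

Lemma i_regular e f k : star e f = Some k ->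
  i f * i e * i f = i f \/ i e * i f * i e = i e.
Proof. by move=> /(star_basic P); apply: basic_regular. Qed.

Lemma ev_image u v : ev g u = ev g v -> ev i u = ev i v.
Proof.
move=> uv; apply: esym.
apply: (gen_ind P (P := fun w => ev i w = ev i u)) uv _ => //.
move=> s e f k t /(star_mul P) efk.
by rewrite !ev_cat !ev_cons -efk !mulgA.
Qed.

(** The canonical homomorphism onto the submonoid generated by the idempotents,
    computed on an arbitrary representing word. *)
Definition image x : T := ev i (projT1 (cid (gen_onto P x))).

Lemma image_ev w : image (ev g w) = ev i w.
Proof. by apply: ev_image; case: cid. Qed.

Lemma imageM x y : image (x * y) = image x * image y.
Proof.
have [u <-] := gen_onto P x; have [v <-] := gen_onto P y.
by rewrite -ev_cat !image_ev ev_cat.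
Qed.

Lemma image_gen e : image (g e) = i e.
Proof.
by have := image_ev [:: e]; rewrite !ev_cons !ev_nil !mulg1.
Qed.

Lemma gen_fixl e k : g e * g k = g k <-> i e * i k = i k.
Proof.
split=> [ek|ek]; first by rewrite -!image_gen -imageM ek.
by apply: gen_mul => //; constructor 2.
Qed.

Lemma gen_fixr e k : g k * g e = g k <-> i k * i e = i k.
Proof.
split=> [ek|ek]; first by rewrite -!image_gen -imageM ek.
by apply: gen_mul => //; constructor 1.
Qed.

(** In S the element k y e is an idempotent R-related to k and below e in the
    L-order.  Being an idempotent of S it comes from E, and the products that
    express these relations are basic, so they also hold between generators. *)
Lemma gen_absorbed y e k : y * g e * g k = g k ->
  exists2 h, greenR (g h) (g k) & g h * g e = g h.
Proof.
move=> yek; have {}yek : image y * i e * i k = i k.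
  by rewrite -!image_gen -!imageM yek.
have [|| h hE] := @i_onto_left k (i k * image y * i e).
- by rewrite !mulgA (mulx3 yek) ii.
- by rewrite !mulgA ii.
exists h; last by apply/gen_fixr; rewrite hE -mulgA ii.
split.
  exists (g k); apply/esym/gen_fixl.
  by rewrite hE (mulx3 yek) ii.
by exists (g h); apply/esym/gen_fixl; rewrite hE !mulgA ii.
Qed.

(** Reading u from right to left, each letter f multiplies a generator k that is
    absorbed by f; replacing k by an R-related h with h f = h makes f h a
    basic product, that is, again a generator. *)
Lemma absorbsL_greenR u e :
  absorbsL g u e -> exists k, greenR (g k) (ev g u * g e).
Proof.
elim: u => [|f u IHu] ue.
  by exists e; rewrite ev_nil mul1g; apply: greenR_refl.
have [k kue] := IHu (@absorbsL_suffix _ _ g [:: f] u e ue).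
have [y yfue] := ue.
have [h hk hf] : exists2 h, greenR (g h) (g k) & g h * g f = g h.
  have [[s ueE] [s' kE]] := kue; apply: (@gen_absorbed (ev g u * g e * y)).
  have := congr1 (fun z => ev g u * g e * z) yfue.
  by rewrite ev_cons kE !mulgA (mulx2 (gen_idem e)) => ->.
have [m fhm] : exists m, star f h = Some m.
  by apply: (star_total P); constructor 4; apply/gen_fixr.
exists m; rewrite -(gen_star P fhm) ev_cons -mulgA; apply: greenR_mul.
exact: greenR_trans kue.
Qed.

Definition greenL (a b : M) := @greenR (opposite M) a b.

(** The image of x in S comes from some j in E.  There j is R-related to k and
    L-related to l; these relations between generators hold in [M] too, and an
    H-class contains at most one idempotent. *)
Lemma idempotent_between x k l :
  x * x = x -> greenR (g k) x -> greenL (g l) x -> exists j, g j = x.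
Proof.
move=> xx kx lx.
have kx_x : g k * x = x by apply: greenR_idem kx; apply: gen_idem.
have xl_x : x * g l = x.
  by apply: (@greenR_idem (opposite M) _ _ _ lx); apply: gen_idem.
have xk_k : x * g k = g k.
  by apply: greenR_idem (greenR_sym kx).
have lx_l : g l * x = g l.
  exact: (@greenR_idem (opposite M) _ _ _ (greenR_sym lx)).
have [||j jE] := @i_onto_left k (image x).
- by rewrite -imageM xx.
- by rewrite -image_gen -imageM kx_x.
have jk : g j * g k = g k by apply/gen_fixl; rewrite jE -image_gen -imageM xk_k.
have lj : g l * g j = g l by apply/gen_fixr; rewrite jE -image_gen -imageM lx_l.
have kj : g k * g j = g j by apply/gen_fixl; rewrite jE -image_gen -imageM kx_x.
exists j; rewrite -[RHS]xl_x -lj mulgA xl_x.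
by rewrite -[X in _ = _ * X]kj mulgA xk_k kj.
Qed.

(** A power W^(2n+1) equals W in [M], hence can be cut into at most n = size W
    seeded factors, just as W is cut into its letters. *)
Lemma idempotent_seeded w :
  ev g w * ev g w = ev g w -> (0 < size w)%N -> seeded g w.
Proof.
move=> ww w_gt0; case: w => // e0 w in ww w_gt0 *.
set W := e0 :: w in ww w_gt0 *; set n := size W.
set L := (n * (2 * n).+1)%N.
have [m le_mn mB] : exists2 m, (m <= n)%N &
    blocks g m (segment (fun p : nat => nth e0 W (p %% n)) 0 L).
  have := esym (ev_segment_power e0 w_gt0 (2 * n) ww).
  move/(gen_ind P (P := fun v => exists2 m, (m <= n)%N & blocks g m v)); apply.
    move=> s e f k t efk; have kE := esym (gen_star P efk).
    have ef := gen_regular efk; split=> -[m le_mn mB].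
      have [m' le_m'm m'B] := blocks_contract kE ef mB.
      by exists m'; rewrite // (leq_trans le_m'm).
    by exists m => //; apply: (blocks_expand kE ef).
  by exists n => //; apply: blocks_size.
have [|p [l [lt_nl pS]]] := blocks_long (m := 2 * n) _ mB.
  by rewrite /L; nia.
exact: (seeded_periodic w_gt0 lt_nl ww pS).
Qed.

End Presentation.

Lemma absorbsR_greenL (E : Type) (star : E -> E -> option E)
    (T M : monoidType) (i : E -> T) (g : E -> M) (e : E) v :
  ig_presentation star i g -> absorbsR g e v ->
  exists l, greenL (g l) (g e * ev g v).
Proof.
move=> P [z evz].
have [|l le] :=
  absorbsL_greenR (ig_presentation_opposite P) (u := rev v) (e := e).
  by exists z; rewrite ev_opposite revK /mul /= /opposite_mul mulgA.
by exists l; rewrite ev_opposite revK in le.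
Qed.

Section Classification.

Variables (E : Type) (star : E -> E -> option E).
Variables (T M : monoidType) (i : E -> T) (g : E -> M).
Hypothesis P : ig_presentation star i g.
Implicit Types (e f h k l : E) (u v w : seq E) (x : M) (t : T).

Let ii := i_idem P.

(** * Idempotents *)

(** A seed e of the word u e v makes the element R-related to u e and L-related to
    e v, each of which is related to a generator. *)
Theorem idempotent_gen x : x * x = x -> x = 1 \/ exists e, g e = x.
Proof.
have [w <-] := gen_onto P x => ww.
have [/size0nil->|w_gt0] := posnP (size w); first by left; rewrite ev_nil.
right; have [u [e [v [wE uL vR]]]] := idempotent_seeded P ww w_gt0.
have [k kue] := absorbsL_greenR P uL; have [l lev] := absorbsR_greenL P vR.
move: ww; rewrite wE ev_cat ev_cons => ww.
apply: (idempotent_between P ww (k := k) (l := l)).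
  apply: greenR_trans kue _; split; first by exists (ev g v); rewrite mulgA.
  by have [z evz] := vR; exists z; rewrite -mulgA evz.
apply: greenR_trans lev _; split; first by exists (ev g u).
have [y yue] := uL; exists y; rewrite /mul /= /opposite_mul !mulgA.
by rewrite yue.
Qed.

(** * The class R~ of an element *)

Definition plus w : T := foldr (act i) 1 w.

Lemma plus_cat u v v' :
  greenR (plus v) (plus v') -> greenR (plus (u ++ v)) (plus (u ++ v')).
Proof. by move=> vv'; elim: u => //= e u; apply: act_greenR. Qed.

Lemma plus_ev u v : ev g u = ev g v -> greenR (plus u) (plus v).
Proof.
move=> uv; apply: (gen_ind P (P := fun w => greenR (plus u) (plus w))) uv _.
  move=> s e f k t efk.
  have efkR : greenR (plus (s ++ e :: f :: t)) (plus (s ++ k :: t)).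
    apply: plus_cat; have kE := esym (star_mul P efk).
    exact: (act_product ii (i_onto_left P) kE (i_regular P efk)).
  split=> uR; first exact: greenR_trans uR efkR.
  exact: greenR_trans uR (greenR_sym efkR).
exact: greenR_refl.
Qed.

(** Merging with an idempotent h such that h x = x turns e x into (e h) x, where
    e h is a generator. *)
Lemma act_sound e k q x : greenR (i k) q -> g k * x = x ->
  exists2 m, greenR (i m) (act i e q) & g m * (g e * x) = g e * x.
Proof.
move=> kq kx; have [[h hq he]|nm] := pselect (merges i e q); last first.
  exists e; last by rewrite mulgA (gen_idem P).
  by rewrite act_nmerges //; apply: greenR_refl.
rewrite act_merges; last by exists h.
have eh : basic (i e) (i h) by constructor 4.
have [m ehm] := star_total P eh.
exists m; first by rewrite -(star_mul P ehm); apply: greenR_mul.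
have hx : g h * x = x.
  rewrite -kx mulgA; congr (_ * _); apply/(gen_fixl P).
  exact: (greenR_idem (ii h) (greenR_trans hq (greenR_sym kq))).
have -> : g e * x = g m * x by rewrite -(gen_star P ehm) -mulgA hx.
by rewrite mulgA (gen_idem P).
Qed.

Lemma plus_sound w : (0 < size w)%N ->
  exists2 k, greenR (i k) (plus w) & g k * ev g w = ev g w.
Proof.
case: w => // e w _; elim: w e => [|f w IHw] e.
  exists e; last by rewrite ev_cons mulgA (gen_idem P).
  have -> : plus [:: e] = i e by rewrite /plus /= /act mulg1; case: ifP.
  exact: greenR_refl.
by have [k kR kw] := IHw f; rewrite (ev_cons g e); apply: act_sound kw.
Qed.

(** The relation R~, with the generators as the only test elements. *)
Definition tilde x y := forall e, g e * x = x <-> g e * y = y.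

Lemma tilde_gen k l : tilde (g k) (g l) <-> greenR (i k) (i l).
Proof.
split=> [kl|[kl lk] e].
  split; first by exists (i l); apply/esym/(gen_fixl P)/kl/(gen_idem P).
  by exists (i k); apply/esym/(gen_fixl P)/kl/(gen_idem P).
by split=> /(gen_fixl P) H; apply/(gen_fixl P); apply: greenR_fix H.
Qed.

(** If e w = w then plus (e :: w) is R-related to plus w and is fixed by e by
    construction of [act]. *)
Lemma tilde_plus w : (0 < size w)%N ->
  exists2 k, greenR (i k) (plus w) & tilde (ev g w) (g k).
Proof.
move=> /plus_sound[k kR kw]; exists k => // e; split=> [ew|ek]; last first.
  by rewrite -kw mulgA ek.
apply/(gen_fixl P); apply: greenR_fix (greenR_sym kR) _.
have ewR : greenR (plus (e :: w)) (plus w) by apply: plus_ev; rewrite ev_cons.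
apply: greenR_fix ewR _; rewrite /plus /= /act.
by case: ifP => _; rewrite ?mulgA ii.
Qed.

Lemma tilde_gen_exists x : x <> 1 -> exists k, tilde x (g k).
Proof.
have [[|e w] <-] := gen_onto P x => x_n1; first by rewrite ev_nil in x_n1.
by have [|k _ kw] := @tilde_plus (e :: w); last exists k.
Qed.

(** [plus] factors through R~ by [tilde_gen], and the action of z on R-classes
    computes it for products. *)
Lemma tilde_mul z x y : x <> 1 -> y <> 1 ->
  tilde x y -> tilde (z * x) (z * y).
Proof.
have [s <-] := gen_onto P z.
have [[|e u] <-] := gen_onto P x => // x_n1; first by rewrite ev_nil in x_n1.
have [[|f v] <-] := gen_onto P y => // y_n1; first by rewrite ev_nil in y_n1.
move: (e :: u) (f :: v) (isT : (0 < size (e :: u))%N)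
  (isT : (0 < size (f :: v))%N) => {x_n1 y_n1}u' v' u_gt0 v_gt0 uv; rewrite -!ev_cat.
have [k kR uk] := tilde_plus u_gt0; have [l lR vl] := tilde_plus v_gt0.
have klR : greenR (i k) (i l).
  by apply/tilde_gen => d; rewrite -(uk d) -(vl d); apply: uv.
have [|k' k'R sk'] := @tilde_plus (s ++ u'); first by rewrite size_cat ltn_addl.
have [|l' l'R sl'] := @tilde_plus (s ++ v'); first by rewrite size_cat ltn_addl.
have k'l'R : greenR (i k') (i l').
  apply: greenR_trans k'R _; apply: greenR_trans (greenR_sym l'R).
  by apply: plus_cat; apply: greenR_trans (greenR_sym kR) (greenR_trans klR lR).
move=> d; rewrite (sk' d) (sl' d); exact: (proj2 (tilde_gen k' l') k'l'R d).
Qed.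

End Classification.

(** * Transfer to semigroups *)

Definition adjoin1 (S : Type) : Type := option S.

Section AdjoinOne.

Variable S : semigroupType.

HB.instance Definition _ := Choice.on (adjoin1 S).

Definition adjoin1_mul (x y : adjoin1 S) : adjoin1 S :=
  match x, y with
  | Some a, Some b => Some (a * b)
  | None, _ => y
  | _, None => x
  end.

Let adjoin1_mulA : associative adjoin1_mul.
Proof. by move=> [a|] [b|] [c|] //=; rewrite mulgA. Qed.

Let adjoin1_mul1 : left_id None adjoin1_mul.
Proof. by case. Qed.

Let adjoin1_1mul : right_id None adjoin1_mul.
Proof. by case. Qed.

HB.instance Definition _ :=
  isMonoid.Build (adjoin1 S) adjoin1_mulA adjoin1_mul1 adjoin1_1mul.

Definition to1 (a : S) : adjoin1 S := Some a.

Lemma to1M a b : to1 (a * b) = to1 a * to1 b.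
Proof. by []. Qed.

Lemma to1_neq1 a : to1 a <> 1.
Proof. by []. Qed.

Lemma to1_inj : injective to1.
Proof. by move=> a b []. Qed.

Lemma to1_onto x : x <> 1 -> exists a, to1 a = x.
Proof. by case: x => // a _; exists a. Qed.

End AdjoinOne.

(** The operation [op] is the product of IG(E) or its reverse, according to whether
    [inc] maps into IG(E)^1 or its opposite; the two cases give R~ and L~. *)
Section OneSided.

Variables (E : Type) (star : E -> E -> option E).
Variables (T M : monoidType) (i : E -> T) (g : E -> M).
Hypothesis P : ig_presentation star i g.
Hypothesis g_neq1 : forall e, g e <> 1.
Variables (I : Type) (op : I -> I -> I) (inc : I -> M).
Hypothesis incM : forall a b, inc (op a b) = inc a * inc b.
Hypothesis inc_neq1 : forall a, inc a <> 1.
Hypothesis inc_inj : injective inc.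
Hypothesis inc_onto : forall x, x <> 1 -> exists a, inc a = x.

Definition tilde_op a b :=
  forall e, op e e = e -> (op e a = a <-> op e b = b).

Lemma inc_fix e a : op e a = a <-> inc e * inc a = inc a.
Proof. by rewrite -incM; split=> [->|/inc_inj]. Qed.

Lemma tilde_opE a b : tilde_op a b <-> tilde g (inc a) (inc b).
Proof.
split=> ab e.
  have [d de] := inc_onto (@g_neq1 e); rewrite -de -!inc_fix.
  by apply: ab; apply/inc_fix; rewrite de (gen_idem P).
move=> /inc_fix/(idempotent_gen P)[/inc_neq1//|[d de]].
by rewrite !inc_fix -de.
Qed.

Lemma tilde_op_idem a : exists2 e, op e e = e & tilde_op a e.
Proof.
have [k ak] := tilde_gen_exists P (@inc_neq1 a).
have [e ek] := inc_onto (@g_neq1 k).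
by exists e; [apply/inc_fix; rewrite ek (gen_idem P)
             | apply/tilde_opE; rewrite ek].
Qed.

Lemma tilde_op_mul c a b : tilde_op a b -> tilde_op (op c a) (op c b).
Proof.
by rewrite !tilde_opE !incM; apply: (tilde_mul P); apply: inc_neq1.
Qed.

End OneSided.

Section IG.

Variables (E : choiceType) (star : E -> E -> option E).

Let gen e : adjoin1 (IG star) := to1 (IG_gen star e).

Lemma ev_gen (e : E) w : ev gen (e :: w) = to1 (\pi_(IG star) (e, w)).
Proof.
elim: w e => [|f w IHw] e; first by rewrite ev_cons ev_nil mulg1.
by rewrite ev_cons IHw -to1M -IG_piM.
Qed.

(** Closure of the congruence under products is absorbed by the contexts s and t. *)
Lemma ig_cong_ind (Q : seq E -> Prop) :
  (forall s e f k t, star e f = Some k ->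
     Q (s ++ e :: f :: t) <-> Q (s ++ k :: t)) ->
  forall x y : free_semigroup E, ig_cong star x y ->
  forall s t, Q (s ++ (x.1 :: x.2) ++ t) <-> Q (s ++ (y.1 :: y.2) ++ t).
Proof.
move=> Qstar x y; elim=> {x y} //.
- by move=> e f k efk s t; apply: Qstar.
- by move=> x y _ IH s t; rewrite IH.
- by move=> x y z _ IHxy _ IHyz s t; rewrite IHxy.
move=> x x' y y' _ IHx _ IHy s t.
have cat_mul (a b : free_semigroup E) :
    s ++ ((a * b).1 :: (a * b).2) ++ t = s ++ (a.1 :: a.2) ++ (b.1 :: b.2) ++ t.
  by rewrite /= -catA.
by rewrite !cat_mul IHx 2!(catA s) IHy.
Qed.

Theorem IG_presentation (S : semigroupType) (phi : E -> idempotents S) :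
  partial_iso star (@biorder_star S) phi ->
  ig_presentation star (fun e => to1 (val (phi e))) gen.
Proof.
move=> [[psi phiK psiK] phi_star].
have basicE e f :
    basic (to1 (val (phi e))) (to1 (val (phi f)))
    <-> basic_pair (val (phi e)) (val (phi f)).
  split; last by case/or4P => /eqP h; [constructor 1|constructor 2
    |constructor 3|constructor 4]; rewrite -to1M h.
  by move=> h; apply/or4P; case: h; rewrite -to1M => /to1_inj/eqP h;
    [constructor 1|constructor 2|constructor 3|constructor 4].
have starE e f : omap (val \o phi) (star e f) =
    if basic_pair (val (phi e)) (val (phi f))
    then Some (val (phi e) * val (phi f)) else None.
  by rewrite -biorder_starE -phi_star; case: star.
split.
- by move=> e f /to1_inj/val_inj/(can_inj phiK).
- by move=> e; rewrite -to1M; congr to1; apply/eqP/(valP (phi e)).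
- case=> [a|_]; last by left.
  move=> /to1_inj/eqP aa; right; exists (psi (exist _ a aa)).
  by rewrite psiK.
- move=> e f /basicE ef; have := starE e f; rewrite ef.
  by case: star => // k _; exists k.
- move=> e f k efk; apply/basicE; have := starE e f; rewrite efk.
  by case: ifP.
- move=> e f k efk; rewrite -to1M; have := starE e f; rewrite efk.
  by case: ifP => //= _ [->].
- by move=> e f k efk; rewrite -to1M; congr to1; apply: IG_genM.
- case=> [x|]; last by exists [::]; rewrite ev_nil.
  by exists ((repr x).1 :: (repr x).2); rewrite ev_gen -surjective_pairing reprK.
move=> Q Qstar [|e u] [|f v]; rewrite ?ev_gen ?ev_nil //.
move=> /to1_inj/IG_eqP uv.
by have := ig_cong_ind Qstar uv [::] [::]; rewrite /= !cats0 => ->.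
Qed.

End IG.

Theorem theorem7p3 (E : finType) (star : E -> E -> option E)
    (biordE : biordered_set star) :
  fountain (IG star) /\ congruence_condition (IG star).
Proof.
have [S [phi phi_iso]] := biordE.
have P := IG_presentation phi_iso; have P' := ig_presentation_opposite P.
have gen_neq1 e : to1 (IG_gen star e) <> 1 by apply: to1_neq1.
have inc_neq1 := @to1_neq1 (IG star); have inc_onto := @to1_onto (IG star).
have tildeRE (a b : IG star) : tildeR a b <-> tilde_op *%g a b.
  by split=> ab e; [move/eqP/ab|move=> /eqP/ab].
have tildeLE (a b : IG star) : tildeL a b <-> tilde_op (fun x y => y * x) a b.
  by split=> ab e; [move/eqP/ab|move=> /eqP/ab].
have mulL : forall a b : IG star,
  to1 (b * a) = @mul (opposite (adjoin1 (IG star))) (to1 a) (to1 b) by [].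
have idR := tilde_op_idem P gen_neq1 (@to1M _) inc_neq1 (@to1_inj _) inc_onto.
have idL := tilde_op_idem P' gen_neq1 mulL inc_neq1 (@to1_inj _) inc_onto.
have mulRt := tilde_op_mul P gen_neq1 (@to1M _) inc_neq1 (@to1_inj _) inc_onto.
have mulLt := tilde_op_mul P' gen_neq1 mulL inc_neq1 (@to1_inj _) inc_onto.
split; split.
- by move=> a; have [e /eqP ee /tildeRE ae] := idR a; exists e.
- by move=> a; have [e /eqP ee /tildeLE ae] := idL a; exists e.
- split=> [|a b c /tildeRE/(mulRt c)/tildeRE//]; split.
  + by move=> a e _; split.
  + by move=> a b ab e ee; apply: iff_sym; apply: ab.
  + by move=> a b c ab bc e ee; apply: iff_trans (ab e ee) (bc e ee).
- split=> [|a b c /tildeLE/(mulLt c)/tildeLE//]; split.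
  + by move=> a e _; split.
  + by move=> a b ab e ee; apply: iff_sym; apply: ab.
  + by move=> a b c ab bc e ee; apply: iff_trans (ab e ee) (bc e ee).
Qed.
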